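(* Let $R=\mathbb{Z}[x]$ and $I=(2,x^2+x)$. There is a sequence of elements $a_i$ of $R$, $i\in\mathbb{N}$, such that for each $i\in\mathbb{N}$ the element $a_i$ has an atomic $\tau_I$-factorization of length $2$ and an atomic $\tau_I$-factorization of length $i$.
   Context: Let $R$ be a commutative domain with nonzero identity and $I$ an ideal of $R$. A $\tau_I$-factorization of $a\in R$ of length $k$ is an expression $a=\lambda b_1\cdots b_k$ where $\lambda\in R$ is a unit, the $b_i\in R$ are nonzero nonunits, and $b_i\equiv b_j \pmod I$ for all $1\leq i\leq j\leq k$ (there is no congruence condition on $\lambda$). An element $a$ is a $\tau_I$-atom if the only $\tau_I$-factorizations of $a$ are of length one. An atomic $\tau_I$-factorization is a $\tau_I$-factorization in which every $b_i$ is a $\tau_I$-atom.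
   Formalization: The claim is proved for each i ≥ 2 rather than each i in N: for i = 1 it is false, since an element with an atomic factorization of length 1 is a unit times an atom and so has no factorization of length 2, and for i = 0 the element would be a unit. *)

(* Defs.v *)
From mathcomp Require Import all_boot all_algebra.
From mathcomp Require Import ring.

Set Implicit Arguments.
Unset Strict Implicit.
Unset Printing Implicit Defensive.

Import GRing.Theory.
Local Open Scope ring_scope.

(* The library's [idealr] is restricted to proper ideals with boolean
   membership; here an ideal may be improper and membership is a [Prop]. *)
Record ideal (R : comNzRingType) := Ideal {
  in_ideal :> R -> Prop;
  in_ideal0 : in_ideal 0;
  in_idealD : forall u v, in_ideal u -> in_ideal v -> in_ideal (u + v);
  in_idealM : forall r u, in_ideal u -> in_ideal (r * u) }.

Section IdealGenerated.
Variables (R : comNzRingType) (u v : R).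

Definition in_ideal_gen2 (f : R) : Prop := exists g h : R, f = g * u + h * v.

Lemma in_ideal_gen2_0 : in_ideal_gen2 0.
Proof. by exists 0, 0; ring. Qed.

Lemma in_ideal_gen2_D f1 f2 :
  in_ideal_gen2 f1 -> in_ideal_gen2 f2 -> in_ideal_gen2 (f1 + f2).
Proof.
by move=> [g1 [h1 ->]] [g2 [h2 ->]]; exists (g1 + g2), (h1 + h2); ring.
Qed.

Lemma in_ideal_gen2_M r f : in_ideal_gen2 f -> in_ideal_gen2 (r * f).
Proof. by move=> [g [h ->]]; exists (r * g), (r * h); ring. Qed.

(* The ideal (u, v). *)
Definition ideal_gen2 : ideal R :=
  Ideal in_ideal_gen2_0 in_ideal_gen2_D in_ideal_gen2_M.

End IdealGenerated.

Section TauFactorization.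
Variables (R : idomainType) (I : ideal R).

(* The factorization a = lam * b_1 * ... * b_k, where bs = [:: b_1; ...; b_k]
   and k >= 1; its length is [size bs]. *)
Definition tau_factorization (a lam : R) (bs : seq R) : Prop :=
  [/\ (0 < size bs)%N,
      lam \is a GRing.unit,
      forall b, b \in bs -> b != 0 /\ b \isn't a GRing.unit,
      forall b c, b \in bs -> c \in bs -> I (b - c)
    & a = lam * \prod_(b <- bs) b].

(* 0 and the units have no factorization, so they satisfy this vacuously;
   they are never factors in a [tau_factorization], however. *)
Definition tau_atom (a : R) : Prop :=
  forall lam bs, tau_factorization a lam bs -> size bs = 1%N.

Definition has_atomic_tau_factorization (a : R) (k : nat) : Prop :=
  exists lam bs, [/\ tau_factorization a lam bs,
                     forall b, b \in bs -> tau_atom b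
                   & size bs = k].

End TauFactorization.

(* Main.v *)
Require Import Defs.
From mathcomp Require Import all_boot all_algebra.
From mathcomp Require Import ring.

Import GRing.Theory.
Local Open Scope ring_scope.

(** Take a_i = (X (X + 1))^i.  All its factors below lie in
    I = (2, X^2 + X), hence are congruent modulo I.  The two groupings
      a_i = (X (X + 1)) ... (X (X + 1))
          = (X^(i-1) (X + 1)) (X (X + 1)^(i-1))
    have lengths i and 2.

    Every factor here is an atom because X or X + 1 occurs in it exactly once.
    Let r be the root, 0 or -1, of that linear factor.  As r^2 + r is even,
    elements congruent modulo I have values of the same parity at r.  In a
    tau_I-factorization one factor vanishes at r, so every factor is even
    at r; but after cancelling the simple factor X - r, the remaining product
    is odd at r, which leaves no room for a second factor
    ([tau_atom_simple_root]). *)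

Local Notation I := (ideal_gen2 (2%:R : {poly int}) ('X^2 + 'X)).

(** Evaluation at r modulo 2 factors through the quotient by I, since
    r (r + 1) is even. *)
Lemma even_horner_ideal (r : int) (f : {poly int}) : I f -> (2 %| f.[r])%Z.
Proof.
move=> [g [h ->]].
have even_rr1 : (2 %| r ^+ 2 + r)%Z.
  have [k [-> | ->]] : exists k : int, r = k * 2 \/ r = k * 2 + 1.
  - exists (r %/ 2)%Z; move: (divz_eq r 2).
    have : (r %% 2)%Z = 0 \/ (r %% 2)%Z = 1.
      have := modz_ge0 r (isT : (2 : int) != 0).
      have := ltz_pmod r (isT : (0 < 2 :> int)%R).
      by case: (r %% 2)%Z => [[|[|[]]]|] //; [left | right].
    by case=> -> r_eq; [left; rewrite -[_ * 2]addr0 | right].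
  - by apply/dvdzP; exists (k * (k * 2 + 1)); ring.
  - by apply/dvdzP; exists ((k * 2 + 1) * (k + 1)); ring.
rewrite -polyC_natr hornerD 2!hornerM hornerC hornerD hornerXn hornerX.
by rewrite rpredD // dvdz_mull.
Qed.

(** A second factor c would be congruent to the factor b that vanishes at r,
    hence even at r, and would divide the cofactor g. *)
Lemma tau_atom_simple_root (r : int) (g : {poly int}) :
  ~~ (2 %| g.[r])%Z -> tau_atom I (('X - r%:P) * g).
Proof.
move=> odd_gr lam bs [bs_gt0 lam_unit _ congr_bs f_eq].
have [b b_in b_root] : exists2 b, b \in bs & root b r.
  have : root (lam * \prod_(b <- bs) b) r.
    by rewrite -f_eq rootM root_XsubC eqxx.
  rewrite rootM => /orP[lam_root|].
    move: (mulVr lam_unit) => /(congr1 (horner^~ r)).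
    by rewrite hornerM (rootP lam_root) mulr0 hornerC.
  by rewrite /root horner_prod prodf_seq_eq0 => /hasP[b]; exists b.
have [b' b_eq] := factor_theorem b r b_root.
have bs_perm := perm_to_rem b_in.
have g_eq : g = lam * b' * \prod_(c <- rem b bs) c.
  have X_neq0 : 'X - r%:P != 0 by rewrite polyXsubC_eq0.
  apply: (mulfI X_neq0).
  by rewrite f_eq (perm_big _ bs_perm) big_cons /= {1}b_eq; ring.
rewrite (perm_size bs_perm) /=.
case def_cs: (rem b bs) => [|c cs] //.
have c_in : c \in bs by rewrite (perm_mem bs_perm) def_cs !inE eqxx orbT.
have even_cr : (2 %| c.[r])%Z.
  have := even_horner_ideal r _ (congr_bs c b c_in b_in).
  by rewrite hornerD hornerN (rootP b_root) subr0.
case/negP: odd_gr.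
by rewrite g_eq def_cs big_cons !hornerM dvdz_mull // dvdz_mulr.
Qed.

Local Notation mon m n := ('X ^+ m * ('X + 1) ^+ n : {poly int}).

Lemma tau_atom_mon1n n : tau_atom I (mon 1 n).
Proof.
have -> : mon 1 n = ('X - 0%:P) * ('X + 1) ^+ n by rewrite subr0 expr1.
apply: tau_atom_simple_root.
by rewrite horner_exp hornerD hornerX hornerC add0r expr1n.
Qed.

Lemma tau_atom_monm1 m : tau_atom I (mon m 1).
Proof.
have -> : mon m 1 = ('X - (-1)%:P) * 'X ^+ m.
  by rewrite polyCN opprK expr1 mulrC.
apply: tau_atom_simple_root.
by rewrite hornerXn dvdzE abszX exp1n.
Qed.

Lemma mon_neq0 m n : mon m n != 0.
Proof.
rewrite mulf_neq0 ?expf_neq0 ?polyX_eq0 //.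
by rewrite -[1]opprK -polyCN polyXsubC_eq0.
Qed.

Lemma mon_nonunit m n : mon m.+1 n \isn't a GRing.unit.
Proof.
apply/negP => /mulVr /(congr1 (horner^~ 0)).
by rewrite !hornerM hornerXn expr0n mul0r mulr0 hornerC.
Qed.

Lemma mon_in_ideal m n : I (mon m.+1 n.+1).
Proof. by exists 0, (mon m n); rewrite !exprS; ring. Qed.

Lemma has_atomic_mon (f : {poly int}) (bs : seq {poly int}) :
    (0 < size bs)%N -> f = \prod_(b <- bs) b ->
    (forall b, b \in bs -> tau_atom I b /\ exists m n, b = mon m.+1 n.+1) ->
  has_atomic_tau_factorization I f (size bs).
Proof.
move=> bs_gt0 f_eq bsP; exists 1, bs; split=> // [|b /bsP[] //].
split=> //; rewrite ?unitr1 ?mul1r //.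
- by move=> b /bsP[_ [m [n ->]]]; rewrite mon_neq0 mon_nonunit.
- move=> b c /bsP[_ [m [n ->]]] /bsP[_ [p [q ->]]].
  rewrite -mulN1r; apply: in_idealD; first exact: mon_in_ideal.
  by apply: in_idealM; apply: mon_in_ideal.
Qed.

Theorem mainTheorem2 :
  let I := ideal_gen2 (2%:R : {poly int}) ('X^2 + 'X) in
  exists a : nat -> {poly int},
    forall i : nat, (2 <= i)%N ->
      has_atomic_tau_factorization I (a i) 2 /\
      has_atomic_tau_factorization I (a i) i.
Proof.
move=> J; exists (fun i => mon 1 1 ^+ i) => -[|[|n]] // _; split.
- apply: (has_atomic_mon _ [:: mon n.+1 1; mon 1 n.+1]) => //.
    by rewrite !big_cons big_nil !expr1 exprMn !(exprS _ n.+1); ring.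
  move=> b; rewrite !inE => /orP[] /eqP ->; split.
  + exact: tau_atom_monm1.
  + by exists n, 0%N.
  + exact: tau_atom_mon1n.
  + by exists 0%N, n.
- rewrite -[X in has_atomic_tau_factorization _ _ X](size_nseq n.+2 (mon 1 1)).
  apply: has_atomic_mon => [//||b /nseqP[-> _]].
    by rewrite big_nseq -Monoid.iteropE.
  by split; [exact: tau_atom_mon1n | exists 0%N, 0%N].
Qed.
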